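(* Let $G$ be an abelian group and $\underline{g}=(g_1,\dots,g_m)\in G^m$. If $\mathcal{B}(\mathrm{supp}(\underline{g}))$ has a quadratic Gröbner system, then $\mathcal{B}(\underline{g})$ also has a quadratic Gröbner system, and hence the semigroup algebra $\mathbb{C}[\mathcal{B}(\underline{g})]$ is Koszul.
   Context: $G$ is written multiplicatively. $\mathcal{B}(\underline{g})=\{\alpha\in\mathbb{N}_0^m\mid\prod_i g_i^{\alpha_i}=1\}$ (submonoid of $(\mathbb{N}_0^m,+)$); $\mathrm{supp}(\underline{g})=\{g_1,\dots,g_m\}$, and for a finite $G_0\subseteq G$, $\mathcal{B}(G_0)=\{\alpha\in\mathbb{N}_0^{G_0}\mid\prod_{g\in G_0}g^{\alpha(g)}=1\}$. For a reduced affine monoid $T$ with (finite) atom set $\mathcal{A}(T)$, its defining congruence $\sim_T$ is the congruence on the free commutative monoid $\{x^{\alpha}\mid\alpha\in\mathbb{N}_0^{\mathcal{A}(T)}\}$ with $x^{\alpha}\sim_T x^{\gamma}$ iff $\sum\alpha(t)t=\sum\gamma(t)t$ in $T$. ''$T$ has a quadratic Gröbner system'' means: for some admissible total order $\prec$ (total order with $x\prec y\Rightarrow xz\prec yz$ and $1\prec x$ for $x\ne1$) there is a finite set $\Lambda$ of pairs with $x\sim_T y$, $y\prec x$ for all $(x,y)\in\Lambda$, every element not divisible by a first component of a pair of $\Lambda$ being $\prec$-minimal in its $\sim_T$-class, and $|\lambda|,|\mu|\le2$ for all $(x^{\lambda},x^{\mu})\in\Lambda$. *)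

(* Defs.v *)
From HB Require Import structures.
From mathcomp Require Import all_boot all_order all_algebra.
Set Implicit Arguments. Unset Strict Implicit. Unset Printing Implicit Defensive.
Import GRing.Theory.
Local Open Scope ring_scope.

Notation expvec I := {ffun I -> nat}.

Definition evadd (I : finType) (x y : expvec I) : expvec I :=
  [ffun i => (x i + y i)%N].
Definition ev0 (I : finType) : expvec I := [ffun => 0%N].
Definition evdvd (I : finType) (x y : expvec I) : Prop :=
  forall i, (x i <= y i)%N.
Definition evdeg (I : finType) (x : expvec I) : nat := (\sum_i x i)%N.

(* B(h) for h = (h_1,...,h_n) in G^n, G an abelian group written additively:
   { alpha in N_0^n | sum_i alpha_i h_i = 0 }  (i.e. prod_i h_i^alpha_i = 1). *)
Definition Bmon (G : zmodType) (n : nat) (h : 'I_n -> G) : pred (expvec 'I_n) :=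
  fun alpha => (\sum_(i < n) h i *+ alpha i) == 0.

Definition supp_seq (G : zmodType) (m : nat) (g : 'I_m -> G) : seq G :=
  undup [seq g i | i : 'I_m].

Definition Bsupp (G : zmodType) (m : nat) (g : 'I_m -> G)
  : pred (expvec 'I_(size (supp_seq g))) :=
  Bmon (fun j : 'I_(size (supp_seq g)) => (supp_seq g)`_j).

Arguments Bsupp {G m} g _.

Definition is_atom (I : finType) (T : pred (expvec I)) (t : expvec I) : Prop :=
  T t /\ t <> ev0 I /\
  forall u v, T u -> T v -> t = evadd u v -> u = ev0 I \/ v = ev0 I.

Definition admissible (J : finType) (lt : expvec J -> expvec J -> Prop) : Prop :=
  [/\ forall x, ~ lt x x,
      forall x y z, lt x y -> lt y z -> lt x z,
      forall x y, x <> y -> lt x y \/ lt y x,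
      forall x y z, lt x y -> lt (evadd x z) (evadd y z)
    & forall x, x <> ev0 J -> lt (ev0 J) x].

(* The (finite) atom set A(T) is
   enumerated without repetition by a list [a]; monomials are elements of
   N_0^{A(T)} = N_0^('I_(size a)), and x^alpha ~_T x^gamma iff
   sum alpha(t) t = sum gamma(t) t. *)
Definition eval_atoms (I : finType) (a : seq (expvec I))
  (alpha : expvec 'I_(size a)) : expvec I :=
  [ffun i => (\sum_(j < size a) alpha j * (nth (ev0 I) a j) i)%N].

Definition has_quadratic_groebner (I : finType) (T : pred (expvec I)) : Prop :=
  exists a : seq (expvec I),
    uniq a /\ (forall t, is_atom T t <-> t \in a) /\
    let J := 'I_(size a) in
    let sim := fun x y : expvec J => eval_atoms x = eval_atoms y in
    exists (lt : expvec J -> expvec J -> Prop) (Lambda : seq (expvec J * expvec J)),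
      [/\ admissible lt,
          forall p, p \in Lambda -> sim p.1 p.2 /\ lt p.2 p.1,
          forall x, (forall p, p \in Lambda -> ~ evdvd p.1 x) ->
                    forall y, sim x y -> x = y \/ lt x y
        & forall p, p \in Lambda -> (evdeg p.1 <= 2)%N /\ (evdeg p.2 <= 2)%N].

(* Main.v *)
(* Removing repeated entries of g one at a time (and relabelling indices),
   it suffices to show: if T = B(f) has a quadratic Groebner system, so has
   T' = B(f'), where f' repeats the entry f i0 at a new index.  Folding the new
   coordinate back into i0 maps T' onto T; the atoms of T' are the atoms b of T
   with some share s <= b(i0) moved to the new coordinate, and two monomials in
   the new atoms are equivalent iff their images in the old atoms are
   equivalent and their total shares agree.  Order monomials by their images
   (old order), then by a weight rewarding shares on atoms of larger index and
   concentrated shares (larger weight = smaller), then lexicographically, and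
   take all relations of degree <= 2.  A standard monomial admits no quadratic
   exchange of shares that raises the weight; such "greedy" monomials are
   determined by image and total share, so each is the weight-maximum of its
   fibre.  And if its image were not standard, an old quadratic leading term
   dividing the image would lift to a new quadratic leading term dividing it. *)

Require Import Defs.
From mathcomp Require Import all_boot all_order all_algebra zify boolp.
Set Implicit Arguments. Unset Strict Implicit. Unset Printing Implicit Defensive.
Import Order.TTheory.

Section ExponentVectors.
Variable J : finType.
Implicit Types (x y z : expvec J) (v w : J).

Definition evdelta v : expvec J := [ffun u => (u == v) : nat].
Definition evpair v w : expvec J := evadd (evdelta v) (evdelta w).
Definition evsub x y : expvec J := [ffun i => x i - y i].

Lemma evaddC x y : evadd x y = evadd y x.
Proof. by apply/ffunP=> i; rewrite !ffunE addnC. Qed.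

Lemma evaddI z x y : evadd z x = evadd z y -> x = y.
Proof. by move/ffunP=> h; apply/ffunP=> i; move: (h i); rewrite !ffunE; lia. Qed.

Lemma evpairC v w : evpair v w = evpair w v.
Proof. exact: evaddC. Qed.

Lemma evdegD x y : evdeg (evadd x y) = evdeg x + evdeg y.
Proof. by rewrite /evdeg -big_split; apply: eq_bigr => i _; rewrite ffunE. Qed.

Lemma evdeg0 : evdeg (ev0 J) = 0.
Proof. by rewrite /evdeg big1 // => i _; rewrite ffunE. Qed.

Lemma evdeg_eq0 x : evdeg x = 0 -> x = ev0 J.
Proof.
move/eqP; rewrite /evdeg sum_nat_eq0 => /forallP x0.
by apply/ffunP=> i; rewrite ffunE; apply/eqP; exact: implyP (x0 i) isT.
Qed.

Lemma evdeg_delta v : evdeg (evdelta v) = 1.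
Proof.
rewrite /evdeg (bigD1 v) //= big1 ?ffunE ?eqxx // => i /negbTE iv.
by rewrite ffunE iv.
Qed.

Lemma evdeg_pair v w : evdeg (evpair v w) = 2.
Proof. by rewrite evdegD !evdeg_delta. Qed.

Lemma evneq0_pos x : x <> ev0 J -> exists v, 0 < x v.
Proof.
move=> x_neq0; case: (pickP (fun v => 0 < x v)) => [v xv | x_eq0]; first by exists v.
by case: x_neq0; apply/ffunP=> v; rewrite ffunE; move: (x_eq0 v); case: (x v).
Qed.

Lemma evsubKC x y : evdvd x y -> evadd x (evsub y x) = y.
Proof. by move=> xy; apply/ffunP=> i; rewrite !ffunE; move: (xy i); lia. Qed.

Lemma evdvd_addr x y : evdvd x (evadd x y).
Proof. by move=> i; rewrite ffunE leq_addr. Qed.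

Lemma evdvd_add2l t y z : evdvd (evadd t y) (evadd t z) <-> evdvd y z.
Proof. by split=> yz i; move: (yz i); rewrite !ffunE leq_add2l. Qed.

Lemma evdvd_trans y x z : evdvd x y -> evdvd y z -> evdvd x z.
Proof. by move=> xy yz i; exact: leq_trans (xy i) (yz i). Qed.

Lemma evdvd_delta x v : 0 < x v -> evdvd (evdelta v) x.
Proof. by move=> xv u; rewrite ffunE; case: eqP => [->|]. Qed.

Lemma evdvd_pair x v w :
  0 < x v -> 0 < x w -> v != w \/ 1 < x v -> evdvd (evpair v w) x.
Proof.
move=> xv xw vw u; rewrite !ffunE.
case: (eqVneq u v) => [uv|uv]; case: (eqVneq u w) => [uw|uw] /=;
  rewrite -?uv -?uw in xv xw vw *; try lia.
by case: vw; rewrite ?eqxx //; lia.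
Qed.

End ExponentVectors.

Section LinearForms.
Variable J : finType.
Implicit Types (x y : expvec J) (c : J -> nat).

Definition evdot x c : nat := \sum_v x v * c v.

Lemma evdotD x y c : evdot (evadd x y) c = evdot x c + evdot y c.
Proof. by rewrite /evdot -big_split; apply: eq_bigr => v _; rewrite ffunE mulnDl. Qed.

Lemma evdot0 c : evdot (ev0 J) c = 0.
Proof. by rewrite /evdot big1 // => v _; rewrite ffunE. Qed.

Lemma evdot_delta v c : evdot (evdelta v) c = c v.
Proof.
rewrite /evdot (bigD1 v) //= big1 ?ffunE ?eqxx ?mul1n ?addn0 // => w /negbTE wv.
by rewrite ffunE wv.
Qed.

Lemma evdot_pair v w c : evdot (evpair v w) c = c v + c w.
Proof. by rewrite evdotD !evdot_delta. Qed.

Lemma leq_evdot x c v : x v * c v <= evdot x c.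
Proof. by rewrite /evdot (bigD1 v) //= leq_addr. Qed.

End LinearForms.

Section Pushforward.
Variables (J J' : finType) (tau : J' -> J).
Implicit Types x y : expvec J'.

Definition evmap x : expvec J := [ffun u => \sum_(v | tau v == u) x v].

Lemma evmapD x y : evmap (evadd x y) = evadd (evmap x) (evmap y).
Proof.
by apply/ffunP=> u; rewrite !ffunE -big_split; apply: eq_bigr => v _; rewrite ffunE.
Qed.

Lemma evmap0 : evmap (ev0 J') = ev0 J.
Proof. by apply/ffunP=> u; rewrite !ffunE big1 // => v _; rewrite ffunE. Qed.

Lemma evmap_delta v : evmap (evdelta v) = evdelta (tau v).
Proof.
apply/ffunP=> u; rewrite !ffunE eq_sym; case: (eqVneq (tau v) u) => [<-|tvu].
  rewrite (bigD1 v) //= big1 ?ffunE ?eqxx // => w /andP[_ /negbTE wv].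
  by rewrite ffunE wv.
rewrite big1 // => w /eqP twu; rewrite ffunE.
by case: eqP twu => // -> tvu'; rewrite tvu' eqxx in tvu.
Qed.

Lemma evdeg_evmap x : evdeg (evmap x) = evdeg x.
Proof.
by rewrite /evdeg (partition_big tau xpredT) //=; apply: eq_bigr => u _; rewrite ffunE.
Qed.

Lemma evmap_eq0 x : evmap x = ev0 J <-> x = ev0 J'.
Proof.
split=> [x0|->]; last exact: evmap0.
by apply: evdeg_eq0; rewrite -evdeg_evmap x0 evdeg0.
Qed.

Lemma evdot_evmap x (c : J -> nat) : evdot (evmap x) c = evdot x (c \o tau).
Proof.
rewrite /evdot (partition_big tau xpredT) //=; apply: eq_bigr => u _.
by rewrite ffunE big_distrl; apply: eq_bigr => v /eqP ->.
Qed.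

Lemma evmap_gt0 x u : 0 < evmap x u -> exists2 v, tau v = u & 0 < x v.
Proof.
rewrite ffunE; case: (pickP (fun v => (tau v == u) && (0 < x v))) => [v /andP[/eqP]|x0].
  by exists v.
by rewrite big1 // => v tvu; move: (x0 v); rewrite tvu; case: (x v).
Qed.

Lemma evmap_gt0_tau x v : 0 < x v -> 0 < evmap x (tau v).
Proof. by move=> xv; rewrite ffunE (bigD1 v) //=; exact: leq_trans xv (leq_addr _ _). Qed.

End Pushforward.

Lemma eval_atomsE (K : finType) (s : seq (expvec K)) (y : expvec 'I_(size s)) k :
  eval_atoms y k = evdot y (fun j => (nth (ev0 K) s j) k).
Proof. by rewrite ffunE. Qed.

Section Relabel.
Variables (I I' : finType) (e : I' -> I).
Implicit Types x y : expvec I.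

Definition relabel x : expvec I' := [ffun i => x (e i)].

Lemma relabelD x y : relabel (evadd x y) = evadd (relabel x) (relabel y).
Proof. by apply/ffunP=> i; rewrite !ffunE. Qed.

Lemma relabel0 : relabel (ev0 I) = ev0 I'.
Proof. by apply/ffunP=> i; rewrite !ffunE. Qed.

Lemma evdvd_relabel x y : evdvd x y -> evdvd (relabel x) (relabel y).
Proof. by move=> xy i; rewrite !ffunE. Qed.

Lemma evdeg_relabel x : bijective e -> evdeg (relabel x) = evdeg x.
Proof.
move=> e_bij; rewrite /evdeg (reindex e) /=; last exact: onW_bij.
by apply: eq_bigr => i _; rewrite ffunE.
Qed.

End Relabel.

Lemma relabelK (I I' : finType) (e : I' -> I) (g : I -> I') :
  cancel e g -> cancel (relabel g) (relabel e).
Proof. by move=> eK y; apply/ffunP=> i; rewrite !ffunE eK. Qed.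

Section AtomsPullback.
Variables (I I' : finType) (T : pred (expvec I)) (T' : pred (expvec I')).
Variable phi : expvec I' -> expvec I.
Hypotheses (T'E : forall y, T' y = T (phi y))
  (phiD : {morph phi : x y / evadd x y})
  (phi_eq0 : forall y, phi y = ev0 I <-> y = ev0 I')
  (phi_split : forall y u v, phi y = evadd u v ->
     exists x1 x2, [/\ y = evadd x1 x2, phi x1 = u & phi x2 = v]).

Lemma is_atom_pullback y : is_atom T' y <-> is_atom T (phi y).
Proof.
rewrite /is_atom T'E phi_eq0; split=> -[Ty [y0 y_irr]]; do 2!split=> //.
- move=> u v Tu Tv /phi_split[x1 [x2 [yE x1u x2v]]]; subst u v.
  by rewrite !phi_eq0; apply: y_irr; rewrite ?T'E.
- move=> x1 x2 Tx1 Tx2 yE; rewrite -!phi_eq0.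
  by apply: y_irr; rewrite -?T'E // yE phiD.
Qed.

End AtomsPullback.

Definition strict_total (A : Type) (r : A -> A -> Prop) : Prop :=
  [/\ forall x, ~ r x x, forall x y z, r x y -> r y z -> r x z
    & forall x y, x <> y -> r x y \/ r y x].

Definition add_compatible (A : Type) (add : A -> A -> A) (r : A -> A -> Prop) : Prop :=
  forall x y z, r x y -> r (add x z) (add y z).

Section Lexico.
Variables (A : Type) (B : eqType) (F : A -> B).
Implicit Type s : A -> A -> Prop.

Definition lexico (r : B -> B -> Prop) s x y : Prop :=
  r (F x) (F y) \/ F x = F y /\ s x y.

Lemma lexico_strict_total (r : B -> B -> Prop) s :
  strict_total r -> strict_total s -> strict_total (lexico r s).
Proof.
case=> r_irr r_trans r_tot [s_irr s_trans s_tot]; split.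
- by move=> x [/r_irr|[_ /s_irr]].
- move=> x y z [rxy|[exy sxy]] [ryz|[eyz syz]].
  + by left; exact: r_trans ryz.
  + by left; rewrite -eyz.
  + by left; rewrite exy.
  + by right; split; [rewrite exy | exact: s_trans syz].
- move=> x y xy; case: (eqVneq (F x) (F y)) => [Fxy|/eqP Fxy].
  + by case: (s_tot _ _ xy); [left|right]; right.
  + by case: (r_tot _ _ Fxy); [left|right]; left.
Qed.

Lemma lexico_add_compatible addA addB (r : B -> B -> Prop) s :
  {morph F : x y / addA x y >-> addB x y} ->
  add_compatible addB r -> add_compatible addA s -> add_compatible addA (lexico r s).
Proof.
move=> FD r_add s_add x y z [rxy|[Fxy sxy]]; rewrite /lexico !FD.
  by left; exact: r_add.
by right; rewrite Fxy; split=> //; exact: s_add.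
Qed.

End Lexico.

Lemma gtn_strict_total : strict_total (fun m n : nat => n < m).
Proof.
split=> [m|m n p|m n]; rewrite ?ltnn //; first by move=> nm pn; exact: ltn_trans pn nm.
by move/eqP; rewrite neq_ltn => /orP[]; [right|left].
Qed.

Lemma gtn_add_compatible : add_compatible addn (fun m n : nat => n < m).
Proof. by move=> m n p; rewrite ltn_add2r. Qed.

Lemma admissible_lexico (J J' : finType) (F : expvec J' -> expvec J) lt s :
  {morph F : x y / evadd x y} -> (forall x, F x = ev0 J <-> x = ev0 J') ->
  admissible lt -> strict_total s -> add_compatible (@evadd J') s ->
  admissible (lexico F lt s).
Proof.
move=> FD F_eq0 [lt_irr lt_trans lt_tot lt_add lt_min] s_tot s_add.
have [irr trans tot] := lexico_strict_total F (And3 lt_irr lt_trans lt_tot) s_tot.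
split=> //; first exact: lexico_add_compatible.
by move=> x x0; left; rewrite (proj2 (F_eq0 _) erefl); apply: lt_min; rewrite F_eq0.
Qed.

Definition lexi (J : finType) (x y : expvec J) : Prop :=
  ((codom x : seqlexi nat) < codom y)%O.

Lemma lexi_strict_total (J : finType) : strict_total (@lexi J).
Proof.
split=> [x|x y z|x y xy]; rewrite /lexi ?ltxx //; first exact: lt_trans.
have /lt_total/orP[] : (codom x : seqlexi nat) != codom y; [|by left|by right].
apply/eqP; rewrite !codomE => /eq_in_map xy'; apply: xy; apply/ffunP => v.
by apply: xy'; rewrite mem_enum.
Qed.

Lemma lexi_add_compatible (J : finType) : add_compatible (@evadd J) (@lexi J).
Proof.
move=> x y z; rewrite /lexi !codomE; elim: (enum J) => //= v l IHl.
rewrite !ltxi_cons !ffunE !leEnat !leq_add2r.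
by case/andP=> -> /implyP xy /=; apply/implyP => /xy; exact: IHl.
Qed.

Definition zero_sum (G : zmodType) (I : finType) (f : I -> G) : pred (expvec I) :=
  fun x => (\sum_i f i *+ x i)%R == 0%R.

Section RelabelGroebner.
Variables (I I' : finType) (e : I' -> I) (g : I -> I').
Hypotheses (eK : cancel e g) (gK : cancel g e).
Variables (T : pred (expvec I)) (T' : pred (expvec I')).
Hypothesis T'E : forall x, T' (relabel e x) = T x.

Lemma is_atom_relabel y : is_atom T' y <-> is_atom T (relabel g y).
Proof.
apply: is_atom_pullback => [x|x1 x2|x|x u v gx].
- by rewrite -T'E (relabelK eK).
- exact: relabelD.
- split=> [gx0|->]; last exact: relabel0.
  by rewrite -(relabelK eK x) gx0 relabel0.
- exists (relabel e u), (relabel e v).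
  by rewrite !(relabelK gK) -relabelD -gx (relabelK eK).
Qed.

Lemma has_qgb_relabel : has_quadratic_groebner T -> has_quadratic_groebner T'.
Proof.
case=> a [a_uniq [a_atoms [lt [Lam [lt_adm Lam_rel Lam_std Lam_quad]]]]].
have relabel_inj : injective (relabel e) := can_inj (relabelK gK).
pose a' := map (relabel e) a; have size_a' : size a' = size a by rewrite size_map.
pose toJ := relabel (cast_ord (esym size_a')); pose ofJ := relabel (cast_ord size_a').
have ofJK : cancel ofJ toJ := relabelK (cast_ordKV size_a').
have toJK : cancel toJ ofJ := relabelK (cast_ordK size_a').
have eval_toJ x : eval_atoms x = relabel e (eval_atoms (toJ x)).
  apply/ffunP=> i; rewrite !ffunE (reindex (cast_ord (esym size_a'))) /=.
    by apply: eq_bigr => j _; rewrite ffunE (nth_map (ev0 I)) ?ffunE.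
  by exists (cast_ord size_a') => j _; rewrite ?cast_ordK ?cast_ordKV.
have eval_toJ_eq x y : eval_atoms x = eval_atoms y -> eval_atoms (toJ x) = eval_atoms (toJ y).
  by rewrite !eval_toJ => /relabel_inj.
exists a'; split; first by rewrite map_inj_uniq.
split=> [y|]; first by rewrite is_atom_relabel a_atoms -(mem_map relabel_inj) (relabelK eK).
(* [toJ] is injective: the lexicographic tie-break never applies and only serves
   to make [admissible_lexico] applicable. *)
exists (lexico toJ lt (@lexi _)), [seq (ofJ p.1, ofJ p.2) | p <- Lam]; split.
- apply: admissible_lexico => //; [exact: relabelD | | exact: lexi_strict_total
    | exact: lexi_add_compatible].
  move=> x; split=> [x0|->]; last exact: relabel0.
  by rewrite -(toJK x) x0 /ofJ relabel0.
- move=> _ /mapP[p p_in ->] /=; have [pE p_lt] := Lam_rel p p_in.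
  by rewrite !eval_toJ !ofJK pE; split=> //; left; rewrite !ofJK.
- move=> x x_std y /eval_toJ_eq xy.
  have toJx_std q : q \in Lam -> ~ evdvd q.1 (toJ x).
    move=> q_in /(evdvd_relabel (cast_ord size_a')); rewrite -/ofJ toJK.
    by apply: x_std (ofJ q.1, ofJ q.2) _; apply/mapP; exists q.
  by case: (Lam_std _ toJx_std _ xy) => [/(can_inj toJK)|]; [left|right; left].
- move=> _ /mapP[p p_in ->] /=.
  by rewrite !evdeg_relabel; [exact: Lam_quad | exists (cast_ord (esym size_a')) ..];
    move=> j; rewrite ?cast_ordK ?cast_ordKV.
Qed.

End RelabelGroebner.

Lemma zero_sum_relabel (G : zmodType) (I I' : finType) (f : I -> G) (f' : I' -> G)
    (e : I' -> I) x :
  bijective e -> f' =1 f \o e -> zero_sum f' (relabel e x) = zero_sum f x.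
Proof.
move=> e_bij f'E; rewrite /zero_sum (reindex e) /=; last exact: onW_bij.
by congr (_ == _); apply: eq_bigr => i _; rewrite ffunE f'E.
Qed.

Lemma has_qgb_zero_sum_relabel (G : zmodType) (I I' : finType) (f : I -> G) (f' : I' -> G)
    (e : I' -> I) :
  bijective e -> f' =1 f \o e ->
  has_quadratic_groebner (zero_sum f) -> has_quadratic_groebner (zero_sum f').
Proof.
move=> e_bij f'E; have [g eK gK] := e_bij.
by apply: (has_qgb_relabel eK gK) => x; exact: zero_sum_relabel.
Qed.

Lemma big_option (R : Type) (idx : R) (op : Monoid.com_law idx) (I : finType)
    (F : option I -> R) :
  \big[op/idx]_o F o = op (F None) (\big[op/idx]_i F (Some i)).
Proof.
rewrite -(big_map Some xpredT F).
have -> : op (F None) (\big[op/idx]_(o <- [seq Some i | i <- index_enum I]) F o) =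
    \big[op/idx]_(o <- None :: [seq Some i | i <- index_enum I]) F o by rewrite big_cons.
apply: perm_big; apply: uniq_perm.
- exact: index_enum_uniq.
- rewrite /= map_inj_uniq ?index_enum_uniq ?andbT; last by move=> i j [].
  by apply/mapP=> -[].
- by case=> [i|]; rewrite mem_index_enum inE //= map_f ?mem_index_enum.
Qed.

Definition wgt (L c s : nat) : nat := L * c.+1 * s + s * s.

Lemma wgt_shift L c1 c2 s1 s2 : c1 < c2 -> 0 < s1 -> s1.*2 < L ->
  wgt L c1 s1 + wgt L c2 s2 < wgt L c1 s1.-1 + wgt L c2 s2.+1.
Proof.
move=> c12; case: s1 => // t _ tL; rewrite /wgt.
have : L * c1.+1 + L <= L * c2.+1 by rewrite addnC -mulnS leq_mul2l ltnS c12 orbT.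
nia.
Qed.

Lemma wgt_concentrate L c s1 s2 : 0 < s2 <= s1 ->
  wgt L c s1 + wgt L c s2 < wgt L c s1.+1 + wgt L c s2.-1.
Proof. by case: s2 => // t; rewrite /wgt; nia. Qed.

Section Duplicate.
Variables (G : zmodType) (I : finType) (f : I -> G) (i0 : I).
Implicit Type x : expvec (option I).

Definition dup (o : option I) : G := if o is Some i then f i else f i0.

(* The new coordinate [None] is a copy of [i0]: [merge] adds it back to [i0],
   and [unmerge b s] moves a share [s] of [b i0] onto it. *)
Definition merge x : expvec I := [ffun i => x (Some i) + (i == i0) * x None].

Definition unmerge (b : expvec I) (s : nat) : expvec (option I) :=
  [ffun o => if o is Some i then b i - (i == i0) * s else s].

Lemma mergeD : {morph merge : x y / evadd x y}.
Proof. by move=> x y; apply/ffunP=> i; rewrite !ffunE; case: (i == i0) => /=; lia. Qed.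

Lemma merge_None_le x : x None <= merge x i0.
Proof. by rewrite ffunE eqxx mul1n leq_addl. Qed.

Lemma merge_unmerge (b : expvec I) s : s <= b i0 -> merge (unmerge b s) = b.
Proof. by move=> sb; apply/ffunP=> i; rewrite !ffunE; case: eqP => [->|] /=; lia. Qed.

Lemma unmerge_merge x : unmerge (merge x) (x None) = x.
Proof. by apply/ffunP=> -[i|]; rewrite !ffunE //; case: eqP => /=; lia. Qed.

Lemma merge_eq0 x : merge x = ev0 I <-> x = ev0 (option I).
Proof.
split=> [x0|->]; last by apply/ffunP=> i; rewrite !ffunE muln0.
have xN0 : x None = 0 by have := merge_None_le x; rewrite x0 ffunE; lia.
apply/ffunP=> -[i|]; rewrite ffunE ?xN0 //.
by move/ffunP: x0 => /(_ i); rewrite !ffunE xN0 muln0 addn0.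
Qed.

Lemma merge_split x u v : merge x = evadd u v ->
  exists x1 x2, [/\ x = evadd x1 x2, merge x1 = u & merge x2 = v].
Proof.
move=> /ffunP xuv.
have [s [s_u s_x s_min]] : exists s, [/\ s <= u i0, s <= x None & s = u i0 \/ s = x None].
  by exists (minn (u i0) (x None)); rewrite geq_minl geq_minr /minn; case: ltnP; split; auto.
have xs_le : x None - s <= v i0 by move: (xuv i0); rewrite !ffunE eqxx; lia.
exists (unmerge u s), (unmerge v (x None - s)); rewrite !merge_unmerge //.
split=> //; apply/ffunP=> -[i|]; rewrite !ffunE; last by rewrite subnKC.
by move: (xuv i); rewrite !ffunE; case: eqP => [->|] /=; lia.
Qed.

Lemma zero_sum_dup x : zero_sum dup x = zero_sum f (merge x).
Proof.
rewrite /zero_sum big_option /=; congr (_ == _).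
rewrite [RHS](eq_bigr (fun i => f i *+ x (Some i) + f i *+ ((i == i0) * x None)))%R;
  last by move=> i _; rewrite ffunE GRing.mulrnDr.
rewrite big_split /=.
have -> : (\sum_i f i *+ ((i == i0) * x None) = f i0 *+ x None)%R.
  rewrite (bigD1 i0) //= eqxx mul1n big1 ?GRing.addr0 // => i /negbTE ->.
  by rewrite mul0n GRing.mulr0n.
by rewrite GRing.addrC.
Qed.

Lemma is_atom_dup x : is_atom (zero_sum dup) x <-> is_atom (zero_sum f) (merge x).
Proof. exact: (is_atom_pullback zero_sum_dup mergeD merge_eq0 merge_split). Qed.

Variables (a : seq (expvec I)) (lt : expvec 'I_(size a) -> expvec 'I_(size a) -> Prop)
  (Lam : seq (expvec 'I_(size a) * expvec 'I_(size a))).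
Hypotheses (a_uniq : uniq a) (a_atoms : forall t, is_atom (zero_sum f) t <-> t \in a)
  (lt_adm : admissible lt)
  (Lam_rel : forall p, p \in Lam -> eval_atoms p.1 = eval_atoms p.2 /\ lt p.2 p.1)
  (Lam_std : forall u : expvec 'I_(size a), (forall p, p \in Lam -> ~ evdvd p.1 u) ->
     forall u', eval_atoms u = eval_atoms u' -> u = u' \/ lt u u')
  (Lam_quad : forall p, p \in Lam -> evdeg p.1 <= 2 /\ evdeg p.2 <= 2).

Definition atoms' : seq (expvec (option I)) :=
  undup [seq unmerge b s | b <- a, s <- iota 0 (b i0).+1].

Lemma mem_atoms' x : (x \in atoms') = (merge x \in a).
Proof.
rewrite mem_undup; apply/allpairsPdep/idP => [[b [s [b_in s_in ->]]]|x_in].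
  by rewrite merge_unmerge // -ltnS; move: s_in; rewrite mem_iota.
exists (merge x), (x None); rewrite mem_iota /= ltnS merge_None_le.
by rewrite unmerge_merge.
Qed.

Lemma atoms'_atoms x : is_atom (zero_sum dup) x <-> x \in atoms'.
Proof. by rewrite is_atom_dup a_atoms mem_atoms'. Qed.

Local Notation J := 'I_(size a).
Local Notation J' := 'I_(size atoms').
Implicit Types (c : J) (v w : J') (u : expvec J) (y z : expvec J').

Definition atom c : expvec I := nth (ev0 I) a c.
Definition atom' v : expvec (option I) := nth (ev0 _) atoms' v.

Lemma merge_atom'_in v : merge (atom' v) \in a.
Proof. by rewrite -mem_atoms' mem_nth. Qed.

Fact base_subproof v : index (merge (atom' v)) a < size a.
Proof. by rewrite index_mem merge_atom'_in. Qed.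

Definition base v : J := Ordinal (base_subproof v).
Definition share v : nat := atom' v None.
Definition cap c : nat := atom c i0.

Lemma atom_base v : atom (base v) = merge (atom' v).
Proof. by rewrite /atom nth_index ?merge_atom'_in. Qed.

Lemma atom'E v : atom' v = unmerge (atom (base v)) (share v).
Proof. by rewrite atom_base unmerge_merge. Qed.

Lemma share_le_cap v : share v <= cap (base v).
Proof. by rewrite /cap atom_base merge_None_le. Qed.

Lemma base_share_inj v w : base v = base w -> share v = share w -> v = w.
Proof.
move=> bvw svw; apply/val_inj/eqP.
rewrite -(nth_uniq (ev0 _) (ltn_ord v) (ltn_ord w) (undup_uniq _)).
by change (atom' v == atom' w); rewrite !atom'E bvw svw.
Qed.

Lemma exists_atom' c s : s <= cap c -> exists v, base v = c /\ share v = s.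
Proof.
move=> s_le; pose x := unmerge (atom c) s.
have x_in : x \in atoms' by rewrite mem_atoms' merge_unmerge ?mem_nth.
exists (Ordinal (etrans (index_mem x atoms') x_in)).
have atom'_x : atom' (Ordinal (etrans (index_mem x atoms') x_in)) = x by exact: nth_index.
split; last by rewrite /share atom'_x ffunE.
by apply/val_inj; rewrite /= atom'_x merge_unmerge // index_uniq.
Qed.

Local Notation proj := (evmap base).

Definition total_share y : nat := evdot y share.

Lemma total_shareD y z : total_share (evadd y z) = total_share y + total_share z.
Proof. exact: evdotD. Qed.

Lemma eval_atoms_None y : eval_atoms y None = total_share y.
Proof. by rewrite ffunE. Qed.

Lemma merge_eval y : merge (eval_atoms y) = eval_atoms (proj y).
Proof.
apply/ffunP=> i; rewrite ffunE !eval_atomsE evdot_evmap /evdot big_distrr -big_split.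
by apply: eq_bigr => v _ /=; rewrite nth_index ?merge_atom'_in // ffunE mulnDr mulnCA.
Qed.

Lemma eval_atoms_dupE y z : eval_atoms y = eval_atoms z <->
  eval_atoms (proj y) = eval_atoms (proj z) /\ total_share y = total_share z.
Proof.
split=> [yz|[pyz syz]]; first by rewrite -!merge_eval -!eval_atoms_None yz.
rewrite -(unmerge_merge (eval_atoms y)) -(unmerge_merge (eval_atoms z)).
by rewrite !merge_eval !eval_atoms_None pyz syz.
Qed.

Lemma total_share_le y : total_share y <= evdot (proj y) cap.
Proof. by have := merge_None_le (eval_atoms y); rewrite merge_eval eval_atoms_None eval_atomsE. Qed.

Definition fibre y : expvec J * nat := (proj y, total_share y).

Lemma fibre_eval y z : fibre y = fibre z -> eval_atoms y = eval_atoms z.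
Proof. by case=> pyz syz; apply/eval_atoms_dupE; rewrite pyz. Qed.

Lemma fibreD y z y' z' :
  fibre y = fibre z -> fibre y' = fibre z' -> fibre (evadd y y') = fibre (evadd z z').
Proof. by case=> pyz syz [pyz' syz']; rewrite /fibre !evmapD !total_shareD pyz pyz' syz syz'. Qed.

Lemma fibre_addlI t y z : fibre (evadd t y) = fibre (evadd t z) -> fibre y = fibre z.
Proof.
rewrite /fibre !evmapD !total_shareD => -[/evaddI -> /eqP].
by rewrite eqn_add2l => /eqP ->.
Qed.

Lemma evdeg_fibre y z : fibre y = fibre z -> evdeg y = evdeg z.
Proof. by case=> pyz _; rewrite -(evdeg_evmap base) pyz evdeg_evmap. Qed.

Lemma lift_dvd u y : evdvd u (proj y) -> exists2 y', evdvd y' y & proj y' = u.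
Proof.
have [n] := ubnP (evdeg u); elim: n u y => // n IHn u y deg_u u_dvd.
have [->|/evneq0_pos[c uc]] := pselect (u = ev0 J).
  by exists (ev0 J') => [v|]; rewrite ?evmap0 // ffunE.
have [v bv yv] := evmap_gt0 (leq_trans uc (u_dvd c)).
rewrite -(evsubKC (evdvd_delta uc)) in deg_u u_dvd *.
rewrite -(evsubKC (evdvd_delta yv)) evmapD evmap_delta bv in u_dvd *.
move/evdvd_add2l: u_dvd => /IHn[|y1 y1_dvd <-]; first by rewrite evdegD evdeg_delta in deg_u.
by exists (evadd (evdelta v) y1); [apply/evdvd_add2l | rewrite evmapD evmap_delta bv].
Qed.

Lemma lift_fibre u N : N <= evdot u cap -> exists y, proj y = u /\ total_share y = N.
Proof.
have [n] := ubnP (evdeg u); elim: n u N => // n IHn u N deg_u N_le.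
have [u0|/evneq0_pos[c uc]] := pselect (u = ev0 J).
  by exists (ev0 J'); rewrite evmap0 /total_share evdot0; move: N_le; rewrite u0 evdot0; case: N.
rewrite -(evsubKC (evdvd_delta uc)) evdotD evdot_delta in deg_u N_le *.
set u1 := evsub u (evdelta c) in deg_u N_le *.
have [s [s_cap s_N sN]] : exists s, [/\ s <= cap c, s <= N & N - s <= evdot u1 cap].
  by exists (minn N (cap c)); rewrite geq_minl geq_minr; split=> //; lia.
have [v [bv sv]] := exists_atom' s_cap.
have [|y1 [py1 sy1]] := IHn u1 _ _ sN; first by rewrite evdegD evdeg_delta in deg_u.
exists (evadd (evdelta v) y1); rewrite evmapD evmap_delta bv py1 total_shareD.
by rewrite /total_share evdot_delta -/(total_share _) sy1 sv; split=> //; lia.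
Qed.

(* [wbound] exceeds twice every share: the side condition of [wgt_shift]. *)
Definition wbound : nat := (\max_c cap c).*2.+1.
Definition weight v : nat := wgt wbound (base v) (share v).
Definition wt y : nat := evdot y weight.

Lemma wtD : {morph wt : y z / evadd y z >-> y + z}.
Proof. by move=> y z; exact: evdotD. Qed.

Lemma share_double_lt v : (share v).*2 < wbound.
Proof. by rewrite ltnS leq_double (leq_trans (share_le_cap v)) // leq_bigmax. Qed.

(* Within a fibre a larger weight is smaller, so that the greedy monomial,
   which is the weight-maximum of its fibre, is the least element there. *)
Definition dup_lt : expvec J' -> expvec J' -> Prop :=
  lexico proj lt (lexico wt (fun m n => n < m) (@lexi J')).

Lemma dup_lt_adm : admissible dup_lt.
Proof.
apply: admissible_lexico => //; [exact: evmapD | exact: evmap_eq0 | |].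
- exact: lexico_strict_total gtn_strict_total (lexi_strict_total _).
- by apply: lexico_add_compatible;
    [exact: wtD | exact: gtn_add_compatible | exact: lexi_add_compatible].
Qed.

Definition partial v : bool := 0 < share v < cap (base v).

Definition movable v w : Prop :=
  [/\ base v < base w, 0 < share v & share w < cap (base w)]
  \/ [/\ base v = base w, partial v & partial w].

(* Greedy: shares fill the atoms of largest index first, and at most one
   atom-variable of the support, with multiplicity one, is partially filled. *)
Definition greedy y : Prop := forall v w, evdvd (evpair v w) y -> ~ movable v w.

Definition improvable y : Prop := exists v w z,
  [/\ evdvd (evpair v w) y, fibre (evpair v w) = fibre z & wt (evpair v w) < wt z].

Lemma fibre_pair v w v' w' : base v' = base v -> base w' = base w ->
  share v' + share w' = share v + share w -> fibre (evpair v w) = fibre (evpair v' w').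
Proof.
move=> bv bw svw; rewrite /fibre /total_share !evdot_pair svw.
by rewrite !evmapD !evmap_delta bv bw.
Qed.

Lemma movable_improvable v w : movable v w ->
  exists z, fibre (evpair v w) = fibre z /\ wt (evpair v w) < wt z.
Proof.
case=> [[bvw sv0 swc] | [bvw /andP[sv0 svc] /andP[sw0 swc]]].
  have [v' [bv' sv']] := exists_atom' (leq_trans (leq_pred _) (share_le_cap v)).
  have [w' [bw' sw']] := exists_atom' swc.
  exists (evpair v' w'); split; first by apply: fibre_pair; rewrite // sv' sw'; lia.
  by rewrite /wt !evdot_pair /weight bv' bw' sv' sw'; apply: wgt_shift (share_double_lt v).
wlog sw_le : v w bvw sv0 svc sw0 swc / share w <= share v.
  move=> base_case; case: (leqP (share w) (share v)) => [|/ltnW]; first exact: base_case.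
  by rewrite evpairC; apply: base_case => //; rewrite bvw.
have [v' [bv' sv']] := exists_atom' svc.
have [w' [bw' sw']] := exists_atom' (leq_trans (leq_pred _) (share_le_cap w)).
exists (evpair v' w'); split; first by apply: fibre_pair; rewrite // sv' sw'; lia.
rewrite /wt !evdot_pair /weight bv' bw' sv' sw' -bvw.
by apply: wgt_concentrate; rewrite sw0.
Qed.

Lemma greedy_of_not_improvable y : ~ improvable y -> greedy y.
Proof.
move=> y_std v w vwy /movable_improvable[z [vwz wt_lt]].
by apply: y_std; exists v, w, z.
Qed.

Lemma greedy_dvd y z : evdvd y z -> greedy z -> greedy y.
Proof. by move=> yz z_gr v w vwy; apply: z_gr; exact: evdvd_trans yz. Qed.

Definition top_var y c v : Prop :=
  [/\ 0 < y v, base v = c & forall w, 0 < y w -> base w = c -> share w <= share v].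

Lemma exists_top_var y c : 0 < proj y c -> exists v, top_var y c v.
Proof.
case/evmap_gt0=> v0 bv0 yv0.
have v0P : (0 < y v0) && (base v0 == c) by rewrite yv0 bv0 eqxx.
case: (@arg_maxnP _ v0 (fun v => (0 < y v) && (base v == c)) share v0P).
move=> v /andP[yv /eqP bv] vmax.
by exists v; split=> // w yw bw; apply: vmax; rewrite yw bw eqxx.
Qed.

Lemma greedy_share_le y c v : greedy y -> (forall w, 0 < y w -> base w <= c) ->
  top_var y c v -> share v < cap c -> total_share y <= share v.
Proof.
move=> y_gr below [yv bv vmax] vc.
have shared_partial w : 0 < y w -> 0 < share w -> base w = c /\ partial w.
  move=> yw sw; suff bw : base w = c.
    by rewrite /partial sw bw (leq_ltn_trans (vmax w yw bw) vc).
  have := below w yw; rewrite leq_eqVlt => /orP[/eqP/val_inj // | wc].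
  have wv : w != v by apply/eqP => wv; move: wc; rewrite wv bv ltnn.
  by case: (y_gr w v (evdvd_pair yw yv (or_introl wv))); left; rewrite bv.
have [[t [yt st]] | no_share] := pselect (exists t, 0 < y t /\ 0 < share t).
  have [bt pt] := shared_partial t yt st.
  have yt1 : y t = 1.
    apply/eqP; rewrite eqn_leq yt andbT leqNgt; apply/negP => yt2.
    by case: (y_gr t t (evdvd_pair yt yt (or_intror yt2))); right.
  rewrite /total_share /evdot (bigD1 t) //= big1 ?addn0 => [|w]; last rewrite eq_sym => tw.
    by rewrite yt1 mul1n vmax.
  case: (posnP (y w)) => [-> //|yw]; case: (posnP (share w)) => [-> |sw]; first by rewrite muln0.
  have [bw pw] := shared_partial w yw sw.
  by case: (y_gr t w (evdvd_pair yt yw (or_introl tw))); right; rewrite bt bw.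
rewrite /total_share /evdot big1 // => w _.
case: (posnP (y w)) => [-> //|yw]; case: (posnP (share w)) => [-> |sw]; first by rewrite muln0.
by case: no_share; exists w.
Qed.

Lemma greedy_top_share y z c vy vz : greedy y -> (forall w, 0 < y w -> base w <= c) ->
  top_var y c vy -> top_var z c vz -> total_share y = total_share z -> share vz <= share vy.
Proof.
move=> y_gr below top_y [zv bvz _] syz; rewrite leqNgt; apply/negP => lt_yz.
have vyc : share vy < cap c by apply: leq_trans lt_yz _; rewrite -bvz share_le_cap.
have := greedy_share_le y_gr below top_y vyc; rewrite syz; apply/negP.
rewrite -ltnNge (leq_trans lt_yz) // (leq_trans (leq_pmull _ zv)) //.
exact: leq_evdot.
Qed.

Lemma greedy_unique y z : greedy y -> greedy z -> fibre y = fibre z -> y = z.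
Proof.
have [n] := ubnP (evdeg y); elim: n y z => // n IHn y z deg_y y_gr z_gr yz.
have [py0|/evneq0_pos[c0 yc0]] := pselect (proj y = ev0 J).
  case: yz => pyz _; move: (py0); rewrite pyz => /evmap_eq0 ->.
  exact/(evmap_eq0 base).
have [c yc cmax] := @arg_maxnP _ c0 (fun c => 0 < proj y c) (fun c : J => c : nat) yc0.
have below y' : proj y' = proj y -> forall w, 0 < y' w -> base w <= c.
  by move=> py' w y'w; apply: cmax; rewrite -py' evmap_gt0_tau.
case: (yz) => pyz syz.
have [[vy top_y] [vz top_z]] : (exists vy, top_var y c vy) /\ (exists vz, top_var z c vz).
  by split; apply: exists_top_var; rewrite -?pyz.
have svyz : share vy = share vz.
  apply/eqP; rewrite eqn_leq (greedy_top_share z_gr (below z (esym pyz)) top_z top_y).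
    by rewrite (greedy_top_share y_gr (below y erefl) top_y top_z syz).
  exact: esym syz.
have [[yv bvy _] [zv bvz _]] := (top_y, top_z).
have vyz : vy = vz by apply: base_share_inj; rewrite ?bvy ?bvz.
subst vz; set y1 := evsub y (evdelta vy); set z1 := evsub z (evdelta vy).
have yE : y = evadd (evdelta vy) y1 by rewrite /y1 (evsubKC (evdvd_delta yv)).
have zE : z = evadd (evdelta vy) z1 by rewrite /z1 (evsubKC (evdvd_delta zv)).
have dvd_y1 : evdvd y1 y by rewrite [in X in evdvd _ X]yE evaddC; apply: evdvd_addr.
have dvd_z1 : evdvd z1 z by rewrite [in X in evdvd _ X]zE evaddC; apply: evdvd_addr.
rewrite yE zE; congr evadd; apply: IHn.
- by move: deg_y; rewrite yE evdegD evdeg_delta.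
- exact: greedy_dvd dvd_y1 y_gr.
- exact: greedy_dvd dvd_z1 z_gr.
- by apply: (fibre_addlI (t := evdelta vy)); rewrite -yE -zE.
Qed.

Lemma wt_le y : wt y <= evdeg y * \max_v weight v.
Proof.
rewrite /wt /evdot /evdeg big_distrl; apply: leq_sum => v _.
by rewrite leq_mul2l leq_bigmax orbT.
Qed.

Lemma greedy_wt_max y z : greedy y -> fibre z = fibre y -> z = y \/ wt z < wt y.
Proof.
move=> y_gr; pose B := evdeg y * \max_v weight v.
have [k] := ubnP (B - wt z); elim: k z => // k IHk z zk zy.
have [[v [w [z' [vwz vwz' wt_lt]]]] | z_std] := pselect (improvable z); last first.
  by left; apply: greedy_unique (greedy_of_not_improvable z_std) y_gr zy.
set r := evsub z (evpair v w); pose z1 := evadd z' r.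
have zE : z = evadd (evpair v w) r := esym (evsubKC vwz).
have z1y : fibre z1 = fibre y by rewrite -zy zE; apply: fibreD (esym vwz') erefl.
have wt_z1 : wt z < wt z1.
  by rewrite zE /z1 (wtD (evpair v w)) (wtD z') ltn_add2r.
have wt_z1_le : wt z1 <= B by rewrite /B -(evdeg_fibre z1y) wt_le.
have [|<-|lt_z1y] := IHk z1 _ z1y; first by lia.
- by right.
- by right; exact: ltn_trans wt_z1 lt_z1y.
Qed.

Definition quad_monomials : seq (expvec J') :=
  [seq [ffun v => t v : nat] | t : {ffun J' -> 'I_3}].

Lemma mem_quad_monomials z : evdeg z <= 2 -> z \in quad_monomials.
Proof.
move=> z2; apply/mapP; exists [ffun v => inord (z v)]; first by rewrite mem_enum.
apply/ffunP=> v; rewrite !ffunE inordK // ltnS (leq_trans _ z2) //.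
by rewrite /evdeg (bigD1 v) //= leq_addr.
Qed.

Definition quad_rel (p : expvec J' * expvec J') : Prop :=
  [/\ evdeg p.1 <= 2, evdeg p.2 <= 2, eval_atoms p.1 = eval_atoms p.2 & dup_lt p.2 p.1].

Definition quad_relations : seq (expvec J' * expvec J') :=
  [seq p <- [seq (z1, z2) | z1 <- quad_monomials, z2 <- quad_monomials] | `[< quad_rel p >]].

Lemma mem_quad_relations p : p \in quad_relations <-> quad_rel p.
Proof.
rewrite mem_filter; split=> [/andP[/asboolP //]|p_rel].
rewrite (asboolT p_rel); case: p p_rel => z1 z2 [z1_deg z2_deg _ _].
by apply: allpairs_f; exact: mem_quad_monomials.
Qed.

Definition standard y : Prop := forall p, p \in quad_relations -> ~ evdvd p.1 y.

Lemma standard_not_improvable y : standard y -> ~ improvable y.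
Proof.
move=> y_std [v [w [z [vwy vwz wt_lt]]]]; apply: (y_std (evpair v w, z)) => //.
apply/mem_quad_relations; split=> /=; rewrite -?(evdeg_fibre vwz) ?evdeg_pair //.
  exact: fibre_eval.
by right; case: vwz => pvwz _; split=> //; left.
Qed.

Lemma standard_proj y : standard y -> forall q, q \in Lam -> ~ evdvd q.1 (proj y).
Proof.
move=> y_std q q_in /lift_dvd[y' y'y py'].
have [qE q_lt] := Lam_rel q_in; have [q1_deg q2_deg] := Lam_quad q_in.
have : total_share y' <= evdot q.2 cap.
  by rewrite -[evdot _ _](eval_atomsE _ i0) -qE eval_atomsE -py' total_share_le.
case/lift_fibre=> z [pz sz]; apply: (y_std (y', z)) y'y.
apply/mem_quad_relations; split=> /=; rewrite -?(evdeg_evmap base) ?py' ?pz //.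
  by apply/eval_atoms_dupE; rewrite py' pz qE sz.
by left; rewrite pz py'.
Qed.

Lemma standard_min y : standard y -> forall z, eval_atoms y = eval_atoms z ->
  y = z \/ dup_lt y z.
Proof.
move=> y_std z /eval_atoms_dupE[pyz syz].
have [irr trans tot _ _] := dup_lt_adm; have [lt_irr lt_trans _ _ _] := lt_adm.
case: (eqVneq y z) => [|/eqP /tot[]]; [by left | by right | move=> zy; exfalso].
have y_max := greedy_wt_max (greedy_of_not_improvable (standard_not_improvable y_std)).
case: (zy) => [lt_zy | [pzy wt_lex]].
  case: (Lam_std (standard_proj y_std) pyz) => [pyzE|lt_yz].
    by move: lt_zy; rewrite pyzE; exact: lt_irr.
  by apply: (lt_irr (proj y)); exact: lt_trans lt_zy.
have [|zyE|wt_zy] := y_max z; first by rewrite /fibre pzy syz.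
  by move: zy; rewrite zyE; exact: irr.
by case: wt_lex => [|[]]; lia.
Qed.

Lemma has_qgb_dup : has_quadratic_groebner (zero_sum dup).
Proof.
exists atoms'; split; first exact: undup_uniq.
split; first exact: atoms'_atoms.
exists dup_lt, quad_relations; split.
- exact: dup_lt_adm.
- by move=> p /mem_quad_relations[].
- exact: standard_min.
- by move=> p /mem_quad_relations[].
Qed.

End Duplicate.

Lemma has_qgb_zero_sum_dup (G : zmodType) (I : finType) (f : I -> G) (i0 : I) :
  has_quadratic_groebner (zero_sum f) -> has_quadratic_groebner (zero_sum (dup f i0)).
Proof.
case=> a [a_uniq [a_atoms [lt [Lam [lt_adm Lam_rel Lam_std Lam_quad]]]]].
exact: (has_qgb_dup i0 a_uniq a_atoms lt_adm Lam_rel Lam_std Lam_quad).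
Qed.

Lemma dup_unlift (G : zmodType) n (g : 'I_n.+1 -> G) (i2 : 'I_n.+1) (j1 : 'I_n) :
  g (lift i2 j1) = g i2 -> g =1 dup (fun j : 'I_n => g (lift i2 j)) j1 \o unlift i2.
Proof. by move=> gj1 i /=; case: (unliftP i2 i) => [j ->|->] //=; rewrite ?liftK ?unlift_none. Qed.

Section Support.
Variables (G : zmodType) (s : seq G).
Hypotheses (s_uniq : uniq s)
  (s_qgb : has_quadratic_groebner (zero_sum (fun j : 'I_(size s) => nth 0%R s j))).

Lemma has_qgb_zero_sum_inj m (g : 'I_m -> G) :
  injective g -> codom g =i s -> has_quadratic_groebner (zero_sum g).
Proof.
move=> g_inj g_s.
have index_lt i : index (g i) s < size s by rewrite index_mem -g_s codom_f.
pose e i : 'I_(size s) := Ordinal (index_lt i).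
have gE : g =1 (fun j => nth 0%R s j) \o e by move=> i; rewrite /= nth_index // -g_s codom_f.
apply: (has_qgb_zero_sum_relabel _ gE s_qgb); apply: inj_card_bij.
  by move=> i j eij; apply: g_inj; rewrite !gE; exact: (congr1 (fun k : 'I__ => nth 0%R s k) eij).
by rewrite [X in X <= _]card_ord -(size_codom g); apply: uniq_leq_size => // x; rewrite g_s.
Qed.

Lemma has_qgb_zero_sum_codom m (g : 'I_m -> G) :
  codom g =i s -> has_quadratic_groebner (zero_sum g).
Proof.
elim: m g => [|m IHm] g g_s; first by apply: has_qgb_zero_sum_inj => // -[].
have [/injectiveP g_inj|/injectivePn[i1 [i2 i12 gi12]]] := boolP (injectiveb g).
  exact: has_qgb_zero_sum_inj.
have [j1 i1E|i1E] := unliftP i2 i1; last by rewrite i1E eqxx in i12.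
pose g' (j : 'I_m) := g (lift i2 j).
have g'_s : codom g' =i s.
  move=> x; rewrite -g_s; apply/codomP/codomP => [[j ->]|[i ->]]; first by exists (lift i2 j).
  by case: (unliftP i2 i) => [j ->|->]; [exists j | exists j1; rewrite /g' -i1E gi12].
apply: (has_qgb_zero_sum_relabel (e := unlift i2)) (has_qgb_zero_sum_dup j1 (IHm g' g'_s)).
  exists (fun o => if o is Some j then lift i2 j else i2) => [i|[j|]] /=.
  - by case: (unliftP i2 i) => [j ->|->].
  - by rewrite liftK.
  - by rewrite unlift_none.
by apply: dup_unlift; rewrite -i1E.
Qed.

End Support.

Theorem corollary5p6 (G : zmodType) (m : nat) (g : 'I_m -> G) :
  has_quadratic_groebner (Bsupp g) -> has_quadratic_groebner (Bmon g).
Proof.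
move=> supp_qgb; apply: (has_qgb_zero_sum_codom (undup_uniq _) supp_qgb).
by move=> x; rewrite mem_undup.
Qed.
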